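(* For each $d\ge1$ let $\Sigma=\operatorname{cov}(\mathbf e_1(d))$ where the errors satisfy Assumption A (see context), let $\mathbf M=\mathbf M_d$ be a symmetric positive definite $d\times d$ matrix, and let $\boldsymbol\Delta_d\in\mathbb R^d$ with $\|\boldsymbol\Delta_d\|\neq0$. Let $\mathbf r_d$ be uniformly distributed on the unit sphere of $\mathbb R^d$ and $\mathbf r_{\mathbf M,d}=\mathbf M^{-1/2}\mathbf r_d$. Then for all $\epsilon>0$ there exist constants $c,C>0$, not depending on $d$, such that for all $d$ $$P\left(c\le\mathcal E_1^2(\boldsymbol\Delta_d,\mathbf r_{\mathbf M,d})\,\frac{\operatorname{tr}\big(\mathbf M^{-1/2}\Sigma\,\mathbf M^{-1/2}\big)}{\|\mathbf M^{-1/2}\boldsymbol\Delta_d\|^2}\le C\right)\ge1-\epsilon,$$ where $\operatorname{tr}$ denotes the trace.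
   Context: $\mathcal E_1(\boldsymbol\Delta_d,\mathbf p_d)=|\langle\boldsymbol\Delta_d,\mathbf p_d\rangle|/\tau(\mathbf p_d)$ with $\tau^2(\mathbf p_d)=\mathbf p_d^T\Sigma\,\mathbf p_d$ (the high dimensional efficiency of change point tests based on projecting the data onto $\mathbf p_d$ when the change is $\boldsymbol\Delta_d$). $\mathbf M^{-1/2}$ is the inverse of the symmetric positive definite square root of $\mathbf M$; $\|\cdot\|$ is the Euclidean norm. Assumption A: for each $d$, $\eta_{1,t}(d),\eta_{2,t}(d),\ldots$ are independent with mean $0$, variance $1$ and $\operatorname E|\eta_{i,t}(d)|^\nu\le C'<\infty$ for some $\nu>2$ and all $i,d$; for $t=1,\ldots,T$ the sequences $(\eta_{1,t}(d),\eta_{2,t}(d),\ldots)$ are independent and identically distributed; and the error vectors are $\mathbf e_t(d)=\sum_{j\ge1}\mathbf a_j(d)\,\eta_{j,t}(d)$ with deterministic $\mathbf a_j(d)=(a_{1,j}(d),\ldots,a_{d,j}(d))^T$, $\sum_{j\ge1}a_{l,j}(d)^2<\infty$ for $l=1,\ldots,d$. Hence $\Sigma=\sum_{j\ge1}\mathbf a_j(d)\mathbf a_j(d)^T$ (not necessarily invertible). Every component has positive variance, i.e. the diagonal entries of $\Sigma$ are strictly positive. *)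

(* Defs.v *)
From HB Require Import structures.
From mathcomp Require Import all_boot all_order all_algebra.
From mathcomp Require Import all_classical all_reals all_analysis.

Set Implicit Arguments.
Unset Strict Implicit.
Unset Printing Implicit Defensive.

Import Order.TTheory GRing.Theory Num.Theory.
Import numFieldNormedType.Exports.

Local Open Scope classical_set_scope.
Local Open Scope ring_scope.

Definition dotcv (R : realType) (d : nat) (x y : 'cV[R]_d) : R :=
  (x^T *m y) 0 0.

(* The library norm on matrices is the maximum norm. *)
Definition euclid_norm (R : realType) (d : nat) (x : 'cV[R]_d) : R :=
  Num.sqrt (\sum_(i < d) x i 0 ^+ 2).

Definition posdefmx (R : realType) (d : nat) (M : 'M[R]_d) : Prop :=
  M^T = M /\ forall x : 'cV[R]_d, x != 0 -> 0 < (x^T *m M *m x) 0 0.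

(* The value is unique when M is positive definite; the default 0 is only
   used for matrices without a positive definite square root. *)
Definition sqrtmx (R : realType) (d : nat) (M : 'M[R]_d) : 'M[R]_d :=
  xget 0 [set B : 'M[R]_d | posdefmx B /\ B *m B = M].

Definition invsqrtmx (R : realType) (d : nat) (M : 'M[R]_d) : 'M[R]_d :=
  invmx (sqrtmx M).

Definition tau (R : realType) (d : nat) (Sigma : 'M[R]_d) (p : 'cV[R]_d) : R :=
  Num.sqrt ((p^T *m Sigma *m p) 0 0).

(* When tau Sigma p = 0 the quotient is 0 by the convention x / 0 = 0. *)
Definition efficiency1 (R : realType) (d : nat) (Sigma : 'M[R]_d)
    (Delta p : 'cV[R]_d) : R :=
  `|dotcv Delta p| / tau Sigma p.

(* R^d with its Borel sigma-algebra. *)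
Definition borel_cV (R : realType) (d : nat) :=
  g_sigma_algebraType (@open 'cV[R]_d).

(* R^nat with the product sigma-algebra. *)
Definition borel_seq (R : realType) :=
  g_sigma_algebraType
    (\bigcup_j preimage_set_system [set: nat -> R]
                 (fun x : nat -> R => x j) measurable).

(* The probability measure carried by the unit sphere that is invariant under
   the full orthogonal group (for d = 1 the reflection x |-> - x is needed). *)
Definition uniform_on_sphere (R : realType) (d : nat)
    (mu : probability (borel_cV R d) R) : Prop :=
  mu [set x | euclid_norm (x : 'cV[R]_d) = 1] = 1%E /\
  forall (Q : 'M[R]_d) (B : set (borel_cV R d)),
    Q^T *m Q = 1%:M -> measurable B ->
    mu [set x | B (Q *m (x : 'cV[R]_d))] = mu B.

Definition independent_family (disp disp' : measure_display)
    (Om : measurableType disp) (E : measurableType disp') (R : realType)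
    (P : probability Om R) (I : eqType) (X : I -> Om -> E) : Prop :=
  forall (s : seq I) (B : I -> set E),
    uniq s -> (forall i, i \in s -> measurable (B i)) ->
    P (\bigcap_(i in [set` s]) X i @^-1` B i)
    = (\prod_(i <- s) P (X i @^-1` B i))%E.

Definition identically_distributed (disp disp' : measure_display)
    (Om : measurableType disp) (E : measurableType disp') (R : realType)
    (P : probability Om R) (I : Type) (X : I -> Om -> E) : Prop :=
  forall (i i' : I) (B : set E), measurable B ->
    P (X i @^-1` B) = P (X i' @^-1` B).

Definition covmx (disp : measure_display) (Om : measurableType disp)
    (R : realType) (P : probability Om R) (d : nat) (X : Om -> 'cV[R]_d) :
    'M[R]_d :=
  \matrix_(l, m) fine (covariance P (fun w => X w l 0) (fun w => X w m 0)).

(* The assumption on the errors for one dimension d. The index j >= 1 is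
   shifted to start at 0, and t ranges over 'I_T. The series defining the errors
   is taken in mean square: its terms are independent, centred and have summable
   variances, so it converges in mean square and almost surely to the same
   limit. *)
Record linear_errors (disp : measure_display) (Om : measurableType disp)
    (R : realType) (P : probability Om R) (T d : nat) (nu C' : R)
    (eta : nat -> 'I_T -> {RV P >-> R}) (a : nat -> 'cV[R]_d)
    (e : 'I_T -> {RV P >-> borel_cV R d}) : Prop := LinearErrors {
  le_indep : forall t, independent_family P (fun j : nat => eta j t);
  le_mean : forall j t, ('E_P[eta j t] = 0)%E;
  le_var : forall j t, ('V_P[eta j t] = 1)%E;
  le_moment : forall j t, ('E_P[fun w => (`|eta j t w| `^ nu)%R] <= C'%:E)%E;
  le_seq_indep : @independent_family _ _ Om (borel_seq R) R P 'I_T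
    (fun t w j => eta j t w);
  le_seq_ident : @identically_distributed _ _ Om (borel_seq R) R P 'I_T
    (fun t w j => eta j t w);
  le_coef : forall l, (\sum_(0 <= j <oo) (a j l 0 ^+ 2)%:E < +oo)%E;
  le_series : forall t l,
    ('E_P[fun w => (((e t w : 'cV[R]_d) l 0
                     - \sum_(0 <= j < n) a j l 0 * eta j t w) ^+ 2)%R]
      @[n --> \oo] --> 0)%E
}.

(* Main.v *)
(** Write [v] for [M^(-1/2) Delta] and [N] for [M^(-1/2) Sigma M^(-1/2)], and
    factor the positive semidefinite [N] as [B^T B]. The statistic is then
    [<v, r>^2 / |v|^2] times [tr N / |B r|^2], so it suffices that
    [d <v, r>^2 / |v|^2] and [d |B r|^2 / tr N] are both tight in
    (0, infinity), uniformly in [d]. Both have mean 1, hence Markov's inequality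
    bounds them from above.

    The lower bounds use only that [<v, r>] has the same law for all unit
    vectors [v]. Polarising fourth moments shows that the squared norm of a block
    of [m] coordinates of [r] has mean [m / d] and variance at most [2 m / d^2],
    so it exceeds [m / (2 d)] up to probability [8 / m]. Take [K] unit vectors in
    general position in this block. If the block is not small, fewer than [m] of
    them are nearly orthogonal to [r]; averaging over the [K] vectors,
    the common probability of [|<v, r>|] being small is at most about [m / K].
    Finally, [|B r|^2] is a weighted sum of squares of such projections, and it can
    only be small if projections carrying half of the weight are. *)

Require Import Defs.
From HB Require Import structures.
From mathcomp Require Import all_boot all_order all_algebra.
From mathcomp Require Import all_classical all_reals all_analysis.
From mathcomp Require Import measurable_realfun complex.
From mathcomp Require Import ring lra.

Set Implicit Arguments.
Unset Strict Implicit.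
Unset Printing Implicit Defensive.

Import Order.TTheory GRing.Theory Num.Theory.
Import numFieldNormedType.Exports.

Local Open Scope classical_set_scope.
Local Open Scope ring_scope.

(** * Roots of positive semidefinite matrices *)

(** Newton interpolation: a new node [a] is matched by adding a multiple of [q], which vanishes
    exactly on the earlier nodes. *)
Lemma poly_interpolation (F : fieldType) (f : F -> F) (s : seq F) :
  exists p : {poly F}, forall x, x \in s -> p.[x] = f x.
Proof.
elim: s => [|a s [p ps]]; first by exists 0.
have [as_|as_] := boolP (a \in s).
  by exists p => x; rewrite inE => /predU1P[->|]; exact: ps.
pose q := \prod_(y <- s) ('X - y%:P).
have qs x : (q.[x] == 0) = (x \in s) by rewrite -rootE root_prod_XsubC.
exists (p + ((f a - p.[a]) / q.[a]) *: q) => x; rewrite inE => /predU1P[->|xs].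
  by rewrite hornerD hornerZ divfK ?qs// addrC subrK.
by rewrite hornerD hornerZ (eqP (_ : q.[x] == 0)) ?qs// mulr0 addr0 ps.
Qed.

Lemma trmx_horner_mx (F : fieldType) (n : nat) (A : 'M[F]_n.+1)
    (p : {poly F}) : A^T = A -> (horner_mx A p)^T = horner_mx A p.
Proof.
move=> AT; elim/poly_ind: p => [|p c IH]; first by rewrite rmorph0 trmx0.
rewrite rmorphD rmorphM /= horner_mx_X horner_mx_C linearD /= tr_scalar_mx.
congr (_ + _); rewrite -[LHS]/((_ *m _)^T) trmx_mul IH AT.
exact: (comm_mx_horner p (comm_mx_refl A)).
Qed.

(** With [c] the imaginary unit this expands a Hermitian form at [P + c *: Q]; the second
    hypothesis, which symmetry of [A] supplies for row vectors, cancels the cross terms. *)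
Lemma mulmx_conj_form (F : comNzRingType) (m n : nat) (c : F) (P Q : 'M[F]_(m, n))
    (A : 'M[F]_n) (P' Q' : 'M[F]_(n, m)) :
  c ^+ 2 = -1 -> Q *m A *m P' = P *m A *m Q' ->
  (P + c *: Q) *m A *m (P' - c *: Q') = P *m A *m P' + Q *m A *m Q'.
Proof.
move=> c2 QP; rewrite !mulmxDl !mulmxBr -!scalemxAl -!scalemxAr QP scalerA -expr2 c2.
by rewrite scaleN1r opprK addrA subrK.
Qed.

(** Each eigenvalue is the Hermitian form of [A] at a unit row of [spectralmx]. Splitting that row
    into real and imaginary parts turns it into a sum of two values of the real form. *)
Lemma psd_spectral_ge0 (R : realType) (n : nat) (A : 'M[R]_n) :
  A^T = A -> (forall x : 'cV[R]_n, 0 <= (x^T *m A *m x) 0 0) ->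
  let A_C := map_mx (real_complex R) A in
  A_C = invmx (spectralmx A_C) *m diag_mx (spectral_diag A_C) *m spectralmx A_C /\
  forall j, exists2 y : R, 0 <= y & spectral_diag A_C 0 j = y%:C%C.
Proof.
move=> AT A0 A_C.
have ACr : A_C \is a mxOver Num.real.
  by apply/mxOverP => i j; rewrite mxE complex_real.
have ACs : A_C \is hermsymmx.
  apply: realsym_hermsym => //.
  by apply/is_hermitianmxP; rewrite expr0 scale1r map_mx_id// map_trmx AT.
have /hermitian_normalmx/orthomx_spectralP AE := ACs.
split=> // j.
have /mxOverP/(_ 0 j)/complex_realP[y yE] := hermitian_spectral_diag_real ACs.
exists y => //; rewrite -ler0c -yE.
set U := spectralmx A_C in AE *.
have UU : U *m (map_mx conjc U^T) = 1%:M.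
  by apply/unitarymxP; exact: spectral_unitarymx.
have DE : diag_mx (spectral_diag A_C) = U *m A_C *m map_mx conjc U^T.
  rewrite [in RHS]AE -!mulmxA UU mulmx1 mulmxA mulmxV ?mul1mx//.
  exact: spectral_unit.
pose p := \row_i complex.Re (U j i); pose q := \row_i complex.Im (U j i).
pose cx := map_mx (real_complex R).
have rowU : row j U = cx _ _ p + ('i)%C *: cx _ _ q.
  by apply/rowP => i; rewrite !mxE -complexE.
have rowUc : map_mx conjc (row j U)^T = cx _ _ p^T - ('i)%C *: cx _ _ q^T.
  apply/colP => i; rewrite rowU !mxE.
  rewrite rmorphD rmorphM /=.
  by apply/eqP; rewrite eq_complex /=; apply/andP; split; apply/eqP; ring.
have pAq : q *m A *m p^T = p *m A *m q^T.
  have <- : (p *m A *m q^T)^T = q *m A *m p^T by rewrite !trmx_mul trmxK AT mulmxA.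
  by apply/matrixP => i k; rewrite !ord1 mxE.
have -> : spectral_diag A_C 0 j = ((p *m A *m p^T) 0 0 + (q *m A *m q^T) 0 0)%:C%C.
  have -> : spectral_diag A_C 0 j = diag_mx (spectral_diag A_C) j j.
    by rewrite mxE eqxx mulr1n.
  have -> : diag_mx (spectral_diag A_C) j j
     = (row j U *m A_C *m map_mx conjc (row j U)^T) 0 0.
    by rewrite DE -!row_mul !mxE; apply: eq_bigr => k _; rewrite !mxE.
  rewrite rowUc rowU.
  have -> : ((cx _ _ p + ('i)%C *: cx _ _ q) *m A_C *m (cx _ _ p^T - ('i)%C *: cx _
    _ q^T))
    = cx _ _ (p *m A *m p^T + q *m A *m q^T).
    rewrite mulmx_conj_form ?sqr_i//; first by rewrite /cx map_mxD !map_mxM.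
    by have /(congr1 (cx _ _)) := pAq; rewrite /cx !map_mxM.
  by rewrite !mxE.
have A0r (v : 'rV_n) : 0 <= (v *m A *m v^T) 0 0 by have := A0 v^T; rewrite trmxK.
by rewrite ler0c addr_ge0.
Qed.

(* B is a real polynomial in A, hence symmetric, although the eigenbasis of A
   is complex. *)
Lemma psd_root (R : realType) (n k : nat) (A : 'M[R]_n.+1) : (0 < k)%N ->
  A^T = A -> (forall x : 'cV[R]_n.+1, 0 <= (x^T *m A *m x) 0 0) ->
  exists2 B : 'M[R]_n.+1, B^T = B & B ^+ k = A.
Proof.
move=> k0 AT A0; have [] := psd_spectral_ge0 AT A0.
set A_C := map_mx (real_complex R) A; set U := spectralmx A_C;
  set D := spectral_diag A_C.
move=> AE D0.
have /choice[y yP] : forall j, exists y : R, 0 <= y /\ D 0 j = y%:C%C.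
  by move=> j; have [y] := D0 j; exists y.
(* A single real polynomial takes the k-th root at every eigenvalue, so [p ^+ k - 'X] vanishes on
   the spectrum. *)
have [p pE] := poly_interpolation (fun x => x `^ (k%:R^-1)) [seq y j | j : 'I_n.+1].
exists (horner_mx A p); first exact: trmx_horner_mx.
rewrite -rmorphXn /= -[RHS]horner_mx_X; apply/eqP; rewrite -subr_eq0 -rmorphB /=.
(* That [p ^+ k - 'X] annihilates [A] is checked over the complex numbers, where [A] is conjugate to
   a diagonal matrix. *)
apply/eqP; apply: (map_mx_inj (f := real_complex R)); rewrite map_horner_mx map_mx0.
rewrite -/A_C AE; set q := map_poly _ _.
have -> : horner_mx (invmx U *m diag_mx D *m U) q
    = invmx U *m diag_mx (map_mx (horner q) D) *m U.
  by rewrite -horner_mx_diag; apply: horner_mx_uconjC; exact: spectral_unit.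
have -> : D = map_mx (real_complex R) (\row_j y j).
  by apply/rowP => j; rewrite !mxE (yP j).2.
rewrite (_ : map_mx _ (map_mx _ _) = 0) ?raddf0 ?mulmx0 ?mul0mx//.
apply/rowP => j; rewrite !mxE horner_map !hornerE pE ?map_f ?mem_enum//.
rewrite -powR_mulrn ?powR_ge0// -powRrM mulVf ?pnatr_eq0 -?lt0n// powRr1 ?(yP j).1//.
by rewrite subrr.
Qed.

(* The square of a symmetric fourth root of M is a positive definite square root. *)
Lemma invsqrtmxP (R : realType) (n : nat) (M : 'M[R]_n.+1) : posdefmx M ->
  (invsqrtmx M)^T = invsqrtmx M /\ invsqrtmx M \in unitmx.
Proof.
move=> [MT M0].
have [x|B BT BM] := @psd_root R n 4 M isT MT.
  by have [->|/M0/ltW//] := eqVneq x 0; rewrite mulmx0 mxE.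
have Munit : M \in unitmx.
  rewrite -row_free_unit -kermx_eq0; apply/rowV0P => v /sub_kermxP vM.
  apply/eqP/negPn/negP => v0.
  have /M0 : v^T != 0.
    by apply: contra_neq v0 => /(congr1 trmx); rewrite trmxK trmx0.
  by rewrite trmxK vM mul0mx mxE ltxx.
have Bunit : B \is a GRing.unit by move: Munit; rewrite -BM unitrX_pos.
pose S := B *m B.
have Spd : posdefmx S.
  split=> [|x x0]; first by rewrite trmx_mul BT.
  have Bx : B *m x != 0.
    by apply: contra_neq x0 => Bx; rewrite -(mulKmx Bunit x) Bx mulmx0.
  rewrite /S mulmxA -mulmxA -{1}BT -trmx_mul mxE.
  rewrite (eq_bigr (fun i => (B *m x) i 0 ^+ 2)); last by move=> i _; rewrite mxE.
  rewrite lt_neqAle eq_sym sumr_ge0 ?andbT; last by move=> i _; exact: sqr_ge0.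
  apply: contra Bx; rewrite psumr_eq0; last by move=> i _; exact: sqr_ge0.
  move=> /allP Bx; apply/eqP/colP => i; rewrite [RHS]mxE.
  by apply/eqP; rewrite -sqrf_eq0; apply: Bx; rewrite mem_index_enum.
(* The witness [S] rules out the default value 0 of [sqrtmx]. *)
have [[rT _] rr] : posdefmx (sqrtmx M) /\ sqrtmx M *m sqrtmx M = M.
  apply: (@xgetPex _ 0 [set B | posdefmx B /\ B *m B = M]); exists S; split=> //.
  by rewrite -BM -[RHS]/(B ^+ (2 + 2)) exprD expr2.
split; rewrite /invsqrtmx; first by rewrite trmx_inv rT.
by rewrite unitmx_inv; move: Munit; rewrite -{1}rr unitmx_mul => /andP[].
Qed.

(** * Integrals of functions bounded on a set of full probability *)

(** [G] is going to be the sphere: projections are measurable everywhere but bounded only there. The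
    class is closed under sums, products and powers, which settles integrability over [G]. *)
Definition bounded_measurable (disp : measure_display) (T : measurableType disp)
    (R : realType) (G : set T) (f : T -> R) : Prop :=
  measurable_fun setT f /\ exists M, forall x, G x -> `|f x| <= M.

Lemma bounded_measurable_cst (disp : measure_display) (T : measurableType disp)
    (R : realType) (G : set T) (c : R) : bounded_measurable G (fun=> c).
Proof. by split; [exact: measurable_cst|exists `|c|]. Qed.

Lemma bounded_measurableM (disp : measure_display) (T : measurableType disp)
    (R : realType) (G : set T) (f g : T -> R) :
  bounded_measurable G f -> bounded_measurable G g ->
  bounded_measurable G (fun x => f x * g x).
Proof.
move=> [mf [M fM]] [mg [N gN]]; split; first exact: measurable_funM.
by exists (M * N) => x Gx; rewrite normrM ler_pM ?fM ?gN.
Qed.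

Lemma bounded_measurableX (disp : measure_display) (T : measurableType disp)
    (R : realType) (G : set T) (f : T -> R) (k : nat) :
  bounded_measurable G f -> bounded_measurable G (fun x => f x ^+ k).
Proof.
move=> [mf [M fM]]; split; first exact: measurable_funX.
by exists (M ^+ k) => x Gx; rewrite normrX lerXn2r ?nnegrE ?fM// (le_trans _ (fM x
  Gx)).
Qed.

Lemma bounded_measurable_sum (disp : measure_display) (T : measurableType disp)
    (R : realType) (G : set T) (I : Type) (s : seq I) (f : I -> T -> R) :
  (forall i, bounded_measurable G (f i)) ->
  bounded_measurable G (fun x => \sum_(i <- s) f i x).
Proof.
move=> bf; split; first by apply: measurable_sum => i; case: (bf i).
have /choice[M fM] i : exists M, forall x, G x -> `|f i x| <= M by case: (bf i).
exists (\sum_(i <- s) M i) => x Gx; apply: le_trans (ler_norm_sum _ _ _) _.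
by apply: ler_sum => i _; exact: fM.
Qed.

Lemma bounded_measurable_indic (disp : measure_display) (T : measurableType disp)
    (R : realType) (G A : set T) :
  measurable A -> bounded_measurable G (\1_A : T -> R).
Proof.
move=> mA; split; first exact: measurable_indic.
by exists 1 => x _; rewrite indicE normr_nat lern1 leq_b1.
Qed.

Lemma bounded_measurable_integrable (disp : measure_display)
    (T : measurableType disp) (R : realType) (P : probability T R) (G : set T)
    (f : T -> R) : measurable G -> bounded_measurable G f ->
  P.-integrable G (EFin \o f).
Proof.
move=> mG [mf [M fM]]; apply: measurable_bounded_integrable => //.
- by rewrite (le_lt_trans (probability_le1 _ mG)) ?ltry.
- exact: measurable_funTS.
- by exists M; split=> [|N MN x Gx];
    [exact: num_real|exact: le_trans (fM x Gx) (ltW MN)].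
Qed.

(** Integrability of the partial sums is carried through the induction because additivity of the
    integral requires it. *)
Lemma integrable_Rintegral_sum (disp : measure_display) (T : measurableType disp)
    (R : realType) (P : probability T R) (G : set T) (I : Type) (s : seq I)
    (c : I -> R) (f : I -> T -> R) :
  measurable G -> (forall i, P.-integrable G (EFin \o f i)) ->
  P.-integrable G (EFin \o (fun x => \sum_(i <- s) c i * f i x)) /\
  \int[P]_(x in G) (\sum_(i <- s) c i * f i x) =
  \sum_(i <- s) c i * \int[P]_(x in G) f i x.
Proof.
move=> mG intf; elim: s => [|i s [IH1 IH2]].
  split; last by under eq_Rintegral do rewrite big_nil;
    rewrite big_nil Rintegral_cst// mul0r.
  apply: (bounded_measurable_integrable P mG (f := fun x => \sum_(i <- [::]) c i *
    f i x)).
  under [X in bounded_measurable _ X]eq_fun do rewrite big_nil.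
  exact: bounded_measurable_cst.
have intc : P.-integrable G (EFin \o (fun x => c i * f i x)).
  exact: (integrableZl mG (c i) (intf i)).
have E x : \sum_(j <- i :: s) c j * f j x = c i * f i x + \sum_(j <- s) c j * f j x.
  by rewrite big_cons.
split.
  rewrite (_ : _ \o _ = (fun x => (c i * f i x)%:E + (\sum_(j <- s) c j * f j
    x)%:E)%E).
    exact: integrableD.
  by apply/funext => x /=; rewrite E.
under eq_Rintegral do rewrite E.
by rewrite big_cons -IH2 -RintegralZl// RintegralD.
Qed.

Lemma Rintegral_sum (disp : measure_display) (T : measurableType disp)
    (R : realType) (P : probability T R) (G : set T) (I : Type) (s : seq I)
    (c : I -> R) (f : I -> T -> R) :
  measurable G -> (forall i, bounded_measurable G (f i)) ->
  \int[P]_(x in G) (\sum_(i <- s) c i * f i x) =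
  \sum_(i <- s) c i * \int[P]_(x in G) f i x.
Proof.
move=> mG bf; apply: (integrable_Rintegral_sum _ _ mG _).2 => i.
exact: bounded_measurable_integrable.
Qed.

Lemma probability_setI1 (disp : measure_display) (T : measurableType disp)
    (R : realType) (P : probability T R) (G A : set T) :
  measurable G -> P G = 1%E -> measurable A -> P (A `&` G) = P A.
Proof.
move=> mG PG mA.
have PGC : P (~` G) = 0%E by rewrite probability_setC// PG subee.
have PAG : P (A `\` G) = 0%E.
  apply/eqP; rewrite -measure_le0 -PGC le_measure ?inE//.
    exact: measurableD.
  exact: measurableC.
transitivity (P (A `\` G) + P (A `&` G))%E; first by rewrite PAG add0e.
exact/esym/measureDI.
Qed.

Lemma Rintegral_indic (disp : measure_display) (T : measurableType disp)
    (R : realType) (P : probability T R) (G A : set T) :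
  measurable G -> P G = 1%E -> measurable A ->
  \int[P]_(x in G) \1_A x = fine (P A).
Proof.
move=> mG PG mA; rewrite /Rintegral integral_indic//.
by congr fine; exact: probability_setI1.
Qed.

(** On [G] the function [f] dominates [c] times the indicator of [A]. A general [f] covers second
    moments, Chebyshev bounds and weighted counts of events. *)
Lemma markov_inequality (disp : measure_display) (T : measurableType disp)
    (R : realType) (P : probability T R) (G A : set T) (f : T -> R) (c : R) :
  measurable G -> P G = 1%E -> measurable A -> bounded_measurable G f ->
  (forall x, G x -> 0 <= f x) -> (forall x, G x -> A x -> c <= f x) ->
  c * fine (P A) <= \int[P]_(x in G) f x.
Proof.
move=> mG PG mA bf f0 fc; rewrite -(Rintegral_indic mG PG mA) -RintegralZl//;
  last first.
  by apply: bounded_measurable_integrable => //; exact: bounded_measurable_indic.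
apply: le_Rintegral => //.
- apply: bounded_measurable_integrable => //; apply: bounded_measurableM.
    exact: bounded_measurable_cst.
  exact: bounded_measurable_indic.
- exact: bounded_measurable_integrable.
move=> x Gx; rewrite indicE; have [xA|] := boolP (x \in A).
  by rewrite mulr1 fc//; exact/set_mem.
by rewrite mulr0 f0.
Qed.

(** * Uniform distribution on the sphere *)

Lemma dotcvE (R : realType) (d : nat) (x y : 'cV[R]_d) :
  dotcv x y = \sum_i x i 0 * y i 0.
Proof. by rewrite /dotcv mxE; apply: eq_bigr => i _; rewrite mxE. Qed.

Lemma dotcvC (R : realType) (d : nat) (x y : 'cV[R]_d) : dotcv x y = dotcv y x.
Proof. by rewrite !dotcvE; apply: eq_bigr => i _; rewrite mulrC. Qed.

Lemma dotcvDl (R : realType) (d : nat) (x y z : 'cV[R]_d) :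
  dotcv (x + y) z = dotcv x z + dotcv y z.
Proof. by rewrite /dotcv linearD /= mulmxDl mxE. Qed.

Lemma dotcvZl (R : realType) (d : nat) (c : R) (x y : 'cV[R]_d) :
  dotcv (c *: x) y = c * dotcv x y.
Proof. by rewrite /dotcv linearZ /= -scalemxAl mxE. Qed.

Lemma dotcvNl (R : realType) (d : nat) (x y : 'cV[R]_d) :
  dotcv (- x) y = - dotcv x y.
Proof. by rewrite -scaleN1r dotcvZl mulN1r. Qed.

Lemma dotcvDr (R : realType) (d : nat) (x y z : 'cV[R]_d) :
  dotcv x (y + z) = dotcv x y + dotcv x z.
Proof. by rewrite dotcvC dotcvDl !(dotcvC x). Qed.

Lemma dotcvNr (R : realType) (d : nat) (x y : 'cV[R]_d) :
  dotcv x (- y) = - dotcv x y.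
Proof. by rewrite dotcvC dotcvNl dotcvC. Qed.

Lemma dotcvZr (R : realType) (d : nat) (c : R) (x y : 'cV[R]_d) :
  dotcv x (c *: y) = c * dotcv x y.
Proof. by rewrite dotcvC dotcvZl dotcvC. Qed.

Lemma dotcv_delta (R : realType) (d : nat) (i : 'I_d) (x : 'cV[R]_d) :
  dotcv (delta_mx i 0) x = x i 0.
Proof.
rewrite dotcvE (bigD1 i)//= mxE !eqxx mul1r big1 ?addr0// => j ji.
by rewrite mxE (negbTE ji) mul0r.
Qed.

Lemma dotcv_ge0 (R : realType) (d : nat) (x : 'cV[R]_d) : 0 <= dotcv x x.
Proof. by rewrite dotcvE sumr_ge0// => i _; rewrite -expr2 sqr_ge0. Qed.

Lemma dotcv_eq0 (R : realType) (d : nat) (x : 'cV[R]_d) :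
  (dotcv x x == 0) = (x == 0).
Proof.
rewrite dotcvE psumr_eq0 => [|i _]; last by rewrite -expr2 sqr_ge0.
apply/idP/eqP => [/allP x0|->]; last by apply/allP => i _; rewrite /= mxE mulr0 eqxx.
apply/colP => i; have := x0 i (mem_index_enum i).
by rewrite mxE -expr2 sqrf_eq0 => /eqP.
Qed.

Lemma sqr_euclid_norm (R : realType) (d : nat) (x : 'cV[R]_d) :
  euclid_norm x ^+ 2 = dotcv x x.
Proof.
rewrite dotcvE sqr_sqrtr; last by apply: sumr_ge0 => i _; exact: sqr_ge0.
by apply: eq_bigr => i _; rewrite expr2.
Qed.

Lemma euclid_norm_eq1 (R : realType) (d : nat) (x : 'cV[R]_d) :
  euclid_norm x = 1 <-> dotcv x x = 1.
Proof.
rewrite -sqr_euclid_norm; split=> [->|/eqP]; first by rewrite expr1n.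
by rewrite sqrp_eq1 ?sqrtr_ge0// => /eqP.
Qed.

(** The squared norms of [v + x] and [v - x] are nonnegative and equal 2 plus or minus twice the
    inner product. *)
Lemma dotcv_le1 (R : realType) (d : nat) (v x : 'cV[R]_d) :
  dotcv v v = 1 -> dotcv x x = 1 -> `|dotcv v x| <= 1.
Proof.
move=> v1 x1; have := dotcv_ge0 (v + x); have := dotcv_ge0 (v - x).
rewrite !(dotcvDl, dotcvDr, dotcvNl, dotcvNr) v1 x1 (dotcvC x v) => h1 h2.
by rewrite ler_norml; apply/andP; split; lra.
Qed.

(** The Householder reflection along [v - w] exchanges the two vectors; the identity serves when
    they coincide. *)
Lemma orthogonal_transitive (R : realType) (d : nat) (v w : 'cV[R]_d) :
  dotcv v v = 1 -> dotcv w w = 1 ->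
  exists2 Q : 'M[R]_d, Q^T *m Q = 1%:M & Q^T *m v = w.
Proof.
move=> v1 w1; pose u := v - w; pose n := dotcv u u.
have [/eqP|n0] := eqVneq n 0.
  rewrite dotcv_eq0 subr_eq0 => /eqP ->; exists 1%:M; rewrite trmx1 mul1mx //.
pose Q : 'M[R]_d := 1%:M - (2 / n) *: (u *m u^T).
have QT : Q^T = Q by rewrite linearB /= linearZ /= trmx1 trmx_mul trmxK.
have QM (x : 'cV[R]_d) : Q *m x = x - (2 / n * dotcv u x) *: u.
  rewrite mulmxBl mul1mx -scalemxAl -mulmxA [u^T *m x]mx11_scalar mul_mx_scalar.
  by rewrite scalerA.
exists Q; rewrite QT.
  rewrite {2}/Q mulmxBr mulmx1 -scalemxAr mulmxA QM -/n mulfVK//.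
  rewrite scaler_nat mulr2n opprD addrA subrr sub0r mulNmx scalerN opprK.
  by rewrite subrK.
(* Since [v] and [w] have equal length, the reflection subtracts from [v] exactly one copy of
   [u]. *)
have nE : n = 2 * dotcv u v.
  rewrite /n /u !(dotcvDl, dotcvDr, dotcvNl, dotcvNr) v1 w1 (dotcvC w v).
  ring.
rewrite QM nE; have [u0|uv0] := eqVneq (dotcv u v) 0;
  first by rewrite nE u0 mulr0 eqxx in n0.
have -> : 2 / (2 * dotcv u v) * dotcv u v = 1 by field.
by rewrite scale1r /u opprB addrC subrK.
Qed.

(** * Measurability and common law of the projections *)

Lemma measurable_coord (R : realType) (d : nat) (i : 'I_d) :
  measurable_fun [set: borel_cV R d] (fun x => (x : 'cV[R]_d) i 0).
Proof.
apply: (measurability (@RGenOpens.G R)); first exact: RGenOpens.measurableE.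
move=> _ [_ [a [b ->]] <-]; apply: sub_sigma_algebra; rewrite setTI.
by move/continuousP: (@coord_continuous R d 1 i 0); apply; exact: interval_open.
Qed.

Lemma measurable_dotcv (R : realType) (d : nat) (v : 'cV[R]_d) :
  measurable_fun [set: borel_cV R d] (dotcv v).
Proof.
rewrite (_ : dotcv v = fun x => \sum_i v i 0 * x i 0); last first.
  by apply/funext => x; exact: dotcvE.
apply: measurable_sum => i; apply: measurable_funM; first exact: measurable_cst.
exact: measurable_coord.
Qed.

Lemma measurable_sphere (R : realType) (d : nat) :
  measurable [set x : borel_cV R d | euclid_norm (x : 'cV[R]_d) = 1].
Proof.
have -> : [set x : borel_cV R d | euclid_norm (x : 'cV[R]_d) = 1] =
    (fun x : borel_cV R d => \sum_i (x : 'cV[R]_d) i 0 * (x : 'cV[R]_d) i 0) @^-1`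
      [set 1].
  by apply/seteqP; split=> x /=; rewrite euclid_norm_eq1 dotcvE.
rewrite -[X in measurable X]setTI.
have mf : measurable_fun [set: borel_cV R d]
    (fun x => \sum_i (x : 'cV[R]_d) i 0 * (x : 'cV[R]_d) i 0).
  by apply: measurable_sum => i; apply: measurable_funM; exact: measurable_coord.
exact: mf.
Qed.

Definition sphere (R : realType) (d : nat) : set (borel_cV R d) :=
  [set x | euclid_norm (x : 'cV[R]_d) = 1].

(** Invariance under an orthogonal [Q] whose transpose maps [v] to [w]: projecting [Q *m x] on [v]
    is projecting [x] on [w]. *)
Lemma uniform_law (R : realType) (d : nat) (mu : probability (borel_cV R d) R)
    (v w : 'cV[R]_d) (A : set R) :
  uniform_on_sphere mu -> dotcv v v = 1 -> dotcv w w = 1 -> measurable A ->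
  mu (dotcv v @^-1` A) = mu (dotcv w @^-1` A).
Proof.
move=> [_ inv] v1 w1 mA; have [Q QQ Qv] := orthogonal_transitive v1 w1.
have mB : measurable (dotcv v @^-1` A : set (borel_cV R d)).
  by rewrite -[X in measurable X]setTI; exact: measurable_dotcv.
rewrite -(inv _ _ QQ mB); congr (mu _); apply/seteqP; split=> x /=;
by rewrite -Qv /dotcv trmx_mul trmxK mulmxA.
Qed.

Lemma dotcv_delta1 (R : realType) (d : nat) (i : 'I_d) :
  dotcv (delta_mx i 0) (delta_mx i 0) = 1 :> R.
Proof. by rewrite dotcv_delta mxE !eqxx. Qed.

Lemma bounded_measurable_coord (R : realType) (d : nat) (i : 'I_d) :
  bounded_measurable (@sphere R d) (fun x => (x : 'cV[R]_d) i 0).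
Proof.
split; first exact: measurable_coord.
exists 1 => x /euclid_norm_eq1 x1.
by have := dotcv_le1 (dotcv_delta1 R i) x1; rewrite dotcv_delta.
Qed.

Lemma bounded_measurable_dotcv (R : realType) (d : nat) (v : 'cV[R]_d) :
  bounded_measurable (@sphere R d) (dotcv v).
Proof.
rewrite (_ : dotcv v = fun x => \sum_i v i 0 * x i 0); last first.
  by apply/funext => x; exact: dotcvE.
apply: bounded_measurable_sum => i; apply: bounded_measurableM.
  exact: bounded_measurable_cst.
exact: bounded_measurable_coord.
Qed.

(** The even power makes the integrand nonnegative, so the integral, extended over the null
    complement of the sphere, becomes one against the law of [dotcv v] on the line; [uniform_law]
    identifies these laws. *)
Lemma uniform_moment (R : realType) (d k : nat)
    (mu : probability (borel_cV R d) R) (v w : 'cV[R]_d) :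
  uniform_on_sphere mu -> dotcv v v = 1 -> dotcv w w = 1 ->
  \int[mu]_(x in @sphere R d) (dotcv v x ^+ 2) ^+ k =
  \int[mu]_(x in @sphere R d) (dotcv w x ^+ 2) ^+ k.
Proof.
move=> um v1 w1; pose g (y : R) := ((y ^+ 2) ^+ k)%:E.
have g0 y : (0 <= g y)%E by rewrite lee_fin exprn_ge0 ?sqr_ge0.
have mg : measurable_fun setT g.
  by apply/measurable_EFinP; do 2 apply: measurable_funX; exact: measurable_id.
have mS : measurable (@sphere R d) by exact: measurable_sphere.
have muC : mu (~` (@sphere R d)) = 0%E.
  by rewrite probability_setC// (_ : mu _ = 1%E) ?subee//; case: um.
have E (u : 'cV[R]_d) : (\int[mu]_(x in @sphere R d) g (dotcv u x) =
    \int[mu]_x g (dotcv u x))%E.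
  rewrite [RHS](@ge0_negligible_integral _ _ _ _ _ (~` (@sphere R d)))//.
  - by rewrite setTD setCK.
  - exact: measurableC.
  - by apply: measurableT_comp => //; exact: measurable_dotcv.
congr fine; apply: etrans (E v) _; apply: etrans _ (esym (E w)).
have := @ge0_integral_pushforward _ _ _ _ R _ (measurable_dotcv v) mu _ _
  measurableT mg (fun y _ => g0 y).
have := @ge0_integral_pushforward _ _ _ _ R _ (measurable_dotcv w) mu _ _
  measurableT mg (fun y _ => g0 y).
rewrite !preimage_setT => <- <-; apply: eq_measure_integral.
- exact: measurable_dotcv.
- exact: measurable_dotcv.
- by move=> ? ? A mA _; exact: uniform_law.
Qed.

(** * Moments of order two and four *)

Lemma sphere_sum_sqr (R : realType) (d : nat) (x : 'cV[R]_d) :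
  sphere x -> \sum_i x i 0 ^+ 2 = 1.
Proof.
move=> /euclid_norm_eq1; rewrite dotcvE => <-.
by apply: eq_bigr => i _; rewrite expr2.
Qed.

Lemma measure_sphere (R : realType) (d : nat)
    (mu : probability (borel_cV R d) R) :
  uniform_on_sphere mu -> mu (@sphere R d) = 1%E.
Proof. by case. Qed.

Lemma Rintegral_sphere1 (R : realType) (d : nat)
    (mu : probability (borel_cV R d) R) (f : borel_cV R d -> R) :
  uniform_on_sphere mu -> (forall x, sphere x -> f x = 1) ->
  \int[mu]_(x in @sphere R d) f x = 1.
Proof.
move=> um f1; rewrite (@eq_Rintegral _ _ _ _ _ (fun=> 1)); last first.
  by move=> x /[!inE]; exact: f1.
rewrite Rintegral_cst; last exact: measurable_sphere.
by rewrite mul1r; exact: (congr1 fine (measure_sphere um)).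
Qed.

(** The [d] squared coordinates have a common mean and sum to 1 on the sphere. *)
Lemma uniform_second_moment (R : realType) (d : nat)
    (mu : probability (borel_cV R d) R) (v : 'cV[R]_d) :
  uniform_on_sphere mu -> dotcv v v = 1 ->
  \int[mu]_(x in @sphere R d) dotcv v x ^+ 2 = d%:R^-1.
Proof.
move=> um v1; have mS : measurable (@sphere R d) by exact: measurable_sphere.
have E i : \int[mu]_(x in @sphere R d) (x : 'cV[R]_d) i 0 ^+ 2 =
    \int[mu]_(x in @sphere R d) dotcv v x ^+ 2.
  have := uniform_moment 1 um (dotcv_delta1 R i) v1.
  under eq_Rintegral do rewrite dotcv_delta expr1.
  by move=> ->; apply: eq_Rintegral => x _; rewrite expr1.
have : \int[mu]_(x in @sphere R d)
    (\sum_(i < d) 1 * (x : 'cV[R]_d) i 0 ^+ 2) = 1.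
  apply: Rintegral_sphere1 => // x /sphere_sum_sqr x1.
  by rewrite -[RHS]x1; apply: eq_bigr => i _; rewrite mul1r.
rewrite Rintegral_sum//; last first.
  by move=> i; apply: bounded_measurableX; exact: bounded_measurable_coord.
under eq_bigr do rewrite mul1r E.
rewrite sumr_const card_ord; set m := Rintegral _ _ _.
rewrite -[m *+ d]mulr_natl => dE.
have d0 : d%:R != 0 :> R.
  apply/eqP => d0; move/eqP: dE; rewrite d0 mul0r eq_sym.
  by rewrite oner_eq0.
by apply: (mulfI d0); rewrite dE mulfV.
Qed.

(* Polarisation: the fourth powers of (x_i + x_j) / sqrt 2 and (x_i - x_j) / sqrt 2
   have the same mean as that of x_i. *)
Lemma uniform_mixed_moment (R : realType) (d : nat)
    (mu : probability (borel_cV R d) R) (i j k : 'I_d) :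
  uniform_on_sphere mu -> i != j ->
  \int[mu]_(x in @sphere R d)
    ((x : 'cV[R]_d) i 0 ^+ 2 * (x : 'cV[R]_d) j 0 ^+ 2) =
  (\int[mu]_(x in @sphere R d) ((x : 'cV[R]_d) k 0 ^+ 2) ^+ 2) / 3.
Proof.
move=> um ij; have mS : measurable (@sphere R d) by exact: measurable_sphere.
pose ei : 'cV[R]_d := delta_mx i 0; pose ej : 'cV[R]_d := delta_mx j 0.
pose s : R := Num.sqrt 2^-1.
have s2 : s ^+ 2 = 2^-1 by rewrite sqr_sqrtr.
have eij : dotcv ei ej = 0 by rewrite dotcv_delta mxE (negbTE ij).
have s1 (c : R) : c ^+ 2 = 1 ->
    dotcv (s *: (ei + c *: ej)) (s *: (ei + c *: ej)) = 1.
  move=> c1; rewrite dotcvZl dotcvZr mulrA -expr2 s2.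
  rewrite !(dotcvDl, dotcvDr, dotcvZl, dotcvZr) !dotcv_delta1 (dotcvC ej) eij.
  by rewrite !mulr0 addr0 add0r mulr1 -expr2 c1; field.
set M := (X in X / 3).
have EM (v : 'cV[R]_d) : dotcv v v = 1 ->
    \int[mu]_(x in @sphere R d) (dotcv v x ^+ 2) ^+ 2 = M.
  move=> v1; rewrite (uniform_moment 2 um v1 (dotcv_delta1 R k)).
  by apply: eq_Rintegral => x _; rewrite dotcv_delta.
(* With these weights the four fourth powers add up to [3 * x_i ^ 2 * x_j ^ 2], while the weights
   themselves sum to 1, which leaves the mean [M]. *)
pose l : seq (R * 'cV[R]_d) := [:: (1, s *: (ei + 1 *: ej));
  (1, s *: (ei + (-1) *: ej)); (- 2^-1, ei); (- 2^-1, ej)].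
have bij : bounded_measurable (@sphere R d)
    (fun x => (x : 'cV[R]_d) i 0 ^+ 2 * (x : 'cV[R]_d) j 0 ^+ 2).
  by apply: bounded_measurableM; apply: bounded_measurableX;
    exact: bounded_measurable_coord.
apply: (@mulfI _ 3); first by rewrite pnatr_eq0.
rewrite -RintegralZl//; last exact: bounded_measurable_integrable.
transitivity (\int[mu]_(x in @sphere R d)
    (\sum_(p <- l) p.1 * (dotcv p.2 x ^+ 2) ^+ 2)).
  apply: eq_Rintegral => x _; rewrite /l !big_cons big_nil /=.
  rewrite !(dotcvZl, dotcvDl) !dotcv_delta !exprMn s2.
  by field.
rewrite Rintegral_sum//; last first.
  by move=> p; do 2 apply: bounded_measurableX; exact: bounded_measurable_dotcv.
rewrite /l !big_cons big_nil /= !EM ?s1 ?dotcv_delta1 ?sqrrN ?expr1n//.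
by field.
Qed.

(** Expanding the square gives [m] diagonal terms of mean [M] and [m * (m - 1)] mixed terms of mean
    [M / 3]. *)
Lemma uniform_block_second_moment (R : realType) (d m : nat)
    (mu : probability (borel_cV R d) R) (h : 'I_m -> 'I_d) (k : 'I_d) :
  uniform_on_sphere mu -> injective h ->
  \int[mu]_(x in @sphere R d) (\sum_i (x : 'cV[R]_d) (h i) 0 ^+ 2) ^+ 2 =
  (m * m.+2)%:R / 3 *
  \int[mu]_(x in @sphere R d) ((x : 'cV[R]_d) k 0 ^+ 2) ^+ 2.
Proof.
move=> um hI; have mS : measurable (@sphere R d) by exact: measurable_sphere.
set M := (X in _ * X).
have bij i j : bounded_measurable (@sphere R d)
    (fun x => (x : 'cV[R]_d) i 0 ^+ 2 * (x : 'cV[R]_d) j 0 ^+ 2).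
  by apply: bounded_measurableM; apply: bounded_measurableX;
    exact: bounded_measurable_coord.
have Eii i : \int[mu]_(x in @sphere R d)
    ((x : 'cV[R]_d) i 0 ^+ 2 * (x : 'cV[R]_d) i 0 ^+ 2) = M.
  have := uniform_moment 2 um (dotcv_delta1 R i) (dotcv_delta1 R k).
  under eq_Rintegral do rewrite dotcv_delta.
  under [in RHS]eq_Rintegral do rewrite dotcv_delta.
  by rewrite -/M => <-; apply: eq_Rintegral => x _; rewrite -expr2.
transitivity (\int[mu]_(x in @sphere R d) (\sum_i 1 * \sum_j 1 *
    ((x : 'cV[R]_d) (h i) 0 ^+ 2 * (x : 'cV[R]_d) (h j) 0 ^+ 2))).
  apply: eq_Rintegral => x _; rewrite expr2 big_distrl /=; apply: eq_bigr => i _.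
  by rewrite mul1r big_distrr /=; apply: eq_bigr => j _; rewrite mul1r.
rewrite Rintegral_sum//; last first.
  move=> i; apply: bounded_measurable_sum => j.
  by apply: bounded_measurableM => //; exact: bounded_measurable_cst.
transitivity (\sum_(i < m) (M + (m.-1)%:R * (M / 3))).
  apply: eq_bigr => i _; rewrite mul1r Rintegral_sum// (bigD1 i)//= mul1r Eii.
  congr (_ + _); under eq_bigr => j ji.
    rewrite mul1r (uniform_mixed_moment k um); last first.
      by apply: contra_neq ji => /hI.
    over.
  rewrite sumr_const cardC1 card_ord mulr_natl; congr (_ *+ _).
rewrite sumr_const card_ord -[LHS]mulr_natl.
(* The empty block is separate because [m.-1] is truncated there. *)
case: m h hI => [|m] h hI; first by rewrite !mul0r.
by rewrite natrM -[m.+3]addn3 -[m.+1]addn1 !natrD addn1 /=; field.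
Qed.

(** Chebyshev's inequality around the mean [m / d] at distance [m / (2 d)]: a variance of at most
    [2 m / d ^ 2] gives [8 / m]. *)
Lemma uniform_block_le (R : realType) (d m : nat)
    (mu : probability (borel_cV R d) R) (h : 'I_m -> 'I_d) :
  uniform_on_sphere mu -> injective h -> (0 < m)%N ->
  fine (mu [set x | \sum_i (x : 'cV[R]_d) (h i) 0 ^+ 2 <= m%:R / (2 * d%:R)])
  <= 8 / m%:R.
Proof.
move=> um hI m0; have mS : measurable (@sphere R d) by exact: measurable_sphere.
have d0 : (0 < d)%N by exact: leq_ltn_trans (leq0n _) (ltn_ord (h (Ordinal m0))).
have dR : 0 < d%:R :> R by rewrite ltr0n.
have mR : 0 < m%:R :> R by rewrite ltr0n.
have md : m%:R <= d%:R :> R.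
  by rewrite ler_nat -(card_ord m) -(card_ord d); exact: leq_card hI.
pose k := Ordinal d0.
(* The block of all [d] coordinates has squared norm 1 on the sphere, which determines the fourth
   moment of a coordinate. *)
have M4 : (d * d.+2)%:R / 3 * \int[mu]_(x in @sphere R d) ((x : 'cV[R]_d) k 0 ^+ 2)
  ^+ 2 = 1.
  rewrite -(uniform_block_second_moment k um (@inj_id 'I_d)).
  by apply: Rintegral_sphere1 => // x /sphere_sum_sqr ->; rewrite expr1n.
pose U (x : borel_cV R d) := \sum_i (x : 'cV[R]_d) (h i) 0 ^+ 2.
have bU : bounded_measurable (@sphere R d) U.
  by apply: bounded_measurable_sum => i; apply: bounded_measurableX;
    exact: bounded_measurable_coord.
have EU : \int[mu]_(x in @sphere R d) U x = m%:R / d%:R.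
  transitivity (\int[mu]_(x in @sphere R d) (\sum_i 1 * dotcv (delta_mx (h i) 0) x
    ^+ 2)).
    by apply: eq_Rintegral => x _; apply: eq_bigr => i _; rewrite mul1r dotcv_delta.
  rewrite Rintegral_sum//; last first.
    by move=> i; apply: bounded_measurableX; exact: bounded_measurable_dotcv.
  under eq_bigr do rewrite mul1r uniform_second_moment ?dotcv_delta1//.
  by rewrite sumr_const card_ord mulr_natl.
have EU2 : \int[mu]_(x in @sphere R d) U x ^+ 2 = (m * m.+2)%:R / (d * d.+2)%:R.
  rewrite (uniform_block_second_moment k um hI).
  set I4 := Rintegral _ _ _ in M4 *.
  have dd : (d * d.+2)%:R != 0 :> R by rewrite pnatr_eq0 muln_eq0 negb_or -lt0n d0.
  have -> : I4 = 3 / (d * d.+2)%:R.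
    by apply: (mulfI dd); rewrite mulrCA mulfV// mulr1 -[RHS]mulr1 -M4; field.
  by rewrite mulrA divfK// pnatr_eq0.
pose A : set (borel_cV R d) := [set x | U x <= m%:R / (2 * d%:R)].
rewrite -[X in mu X]/A.
have mA : measurable A.
  by rewrite -[A]setTI; apply: measurable_fun_le => //; exact: bU.1.
have V : (m%:R / (2 * d%:R)) ^+ 2 * fine (mu A) <= 2 * m%:R / d%:R ^+ 2.
  have bC := bounded_measurable_cst (@sphere R d).
  (* The centred square is listed by its three monomials, to be integrated term by term. *)
  pose f x : R := \sum_(n < 3) (tnth [tuple 1; - (2 * m%:R / d%:R);
    (m%:R / d%:R) ^+ 2] n) * U x ^+ (2 - n).
  have fE x : f x = (U x - m%:R / d%:R) ^+ 2.
    by rewrite /f !big_ord_recl big_ord0 /= /tnth /=; field; rewrite gt_eqF.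
  have bf : bounded_measurable (@sphere R d) f.
    apply: bounded_measurable_sum => n; apply: bounded_measurableM => //.
    exact: bounded_measurableX.
  apply: (@le_trans _ _ (\int[mu]_(x in @sphere R d) f x)).
    apply: markov_inequality => //.
    - exact: measure_sphere.
    - by move=> x _; rewrite fE sqr_ge0.
    have qE : m%:R / (2 * d%:R) = m%:R / d%:R / 2 :> R.
      by field; rewrite gt_eqF.
    have q0 : 0 <= m%:R / d%:R :> R by rewrite divr_ge0// ltW.
    move=> x Gx; rewrite /A /= fE qE => Ax.
    (* For [q = m / d] this product equals [(U - q) ^ 2 - (q / 2) ^ 2], and both factors are
       nonnegative when [U] is at most [q / 2]. *)
    have := mulr_ge0 (_ : 0 <= m%:R / d%:R / 2 - U x) (_ : 0 <= 3 / 2 * (m%:R /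
      d%:R) - U x).
    by move=> /(_ ltac:(lra) ltac:(lra)); nra.
  rewrite /f Rintegral_sum//; last by move=> n; exact: bounded_measurableX.
  rewrite !big_ord_recl big_ord0 /= /tnth /=.
  rewrite EU2 (_ : \int[mu]_(x in _) U x ^+ (2 - 1) = m%:R / d%:R); last first.
    by rewrite -EU; apply: eq_Rintegral => x _; rewrite expr1.
  rewrite Rintegral_sphere1//.
  rewrite !natrM -[m.+2]addn2 -[d.+2]addn2 !natrD.
  have y2 : 0 < d%:R + 2 :> R by rewrite addr_gt0.
  (* This is the exact variance; its last factor is at most 1. *)
  rewrite [leLHS](_ : _ =
      2 * m%:R / d%:R ^+ 2 * ((d%:R - m%:R) / (d%:R + 2))); last first.
    by field; rewrite !gt_eqF.
  rewrite ger_pMr ?ler_pdivrMr ?mul1r ?divr_gt0 ?mulr_gt0 ?exprn_gt0//.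
  lra.
have c0 : 0 < (m%:R / (2 * d%:R)) ^+ 2 :> R.
  by rewrite exprn_gt0// divr_gt0// mulr_gt0.
rewrite -(ler_pM2l c0) (le_trans V)// le_eqVlt; apply/orP; left; apply/eqP.
by field; rewrite !gt_eqF.
Qed.

(** * Small balls *)

Lemma le_fine_probability (disp : measure_display) (T : measurableType disp)
    (R : realType) (P : probability T R) (G A B : set T) :
  measurable G -> P G = 1%E -> measurable A -> measurable B ->
  (forall x, G x -> A x -> B x) -> fine (P A) <= fine (P B).
Proof.
move=> mG PG mA mB AB; rewrite -(probability_setI1 mG PG mA).
apply: fine_le; rewrite ?fin_num_measure//; first exact: measurableI.
by apply: le_measure; rewrite ?inE//; [exact: measurableI|move=> x [Ax Gx];
  exact: AB].
Qed.

(* Points of the moment curve: any m of them are linearly independent. *)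
Lemma general_position (R : realType) (m K : nat) : (0 < m)%N ->
  exists v : 'I_K -> 'cV[R]_m, exists L : R,
    [/\ forall k, dotcv (v k) (v k) = 1, 0 <= L &
      forall (x : 'cV[R]_m) (s : R), 0 <= s ->
        (m <= #|[pred k | (`|dotcv (v k) x| <= s)%R]|)%N -> dotcv x x <= L * s ^+ 2].
Proof.
move=> m0; pose y (k : 'I_K) : 'cV[R]_m := \col_i (k%:R ^+ i).
have y0 k : 0 < dotcv (y k) (y k).
  rewrite lt_neqAle dotcv_ge0 andbT eq_sym dotcv_eq0.
  (* The entry of index 0 is 1 for every point, including [k = 0]. *)
  apply/eqP => /colP/(_ (Ordinal m0)); rewrite !mxE expr0 => /eqP.
  by rewrite oner_eq0.
pose n k := Num.sqrt (dotcv (y k) (y k)).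
have n0 k : 0 < n k by rewrite sqrtr_gt0.
(* The rows of [V f] are the selected points, so [V f] maps [x] to its inner products with them. *)
pose V (f : {ffun 'I_m -> 'I_K}) := (Vandermonde m (\row_j (f j)%:R : 'rV[R]_m))^T.
pose l f (i j : 'I_m) := `|invmx (V f) i j| * n (f j).
have l0 f i j : 0 <= l f i j by rewrite mulr_ge0// ltW.
(* Summing over all selections gives one constant valid for whichever [m] vectors are nearly
   orthogonal to [x]; the other selections only add nonnegative terms. *)
pose L := \sum_f \sum_i \sum_j l f i j.
have L0 : 0 <= L by do 3 apply: sumr_ge0 => ? _.
exists (fun k => (n k)^-1 *: y k), (m%:R * L ^+ 2); split.
- move=> k; rewrite dotcvZl dotcvZr mulrA -expr2 exprVn sqr_sqrtr ?dotcv_ge0//.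
  by rewrite mulVf// gt_eqF.
- by rewrite mulr_ge0// exprn_ge0.
move=> x s s0; set A := [pred k | _] => mA.
pose f : {ffun 'I_m -> 'I_K} := [ffun j => enum_val (widen_ord mA j)].
have fA j : `|dotcv (y (f j)) x| <= n (f j) * s.
  rewrite ffunE; have := enum_valP (widen_ord mA j).
  rewrite inE dotcvZl normrM gtr0_norm ?invr_gt0// => h.
  by rewrite -ler_pdivrMl.
have fI : injective f.
  move=> i j; rewrite !ffunE => /enum_val_inj /(congr1 val) /= ij.
  exact/val_inj.
have Vunit : V f \in unitmx.
  rewrite /V unitmx_tr unitmxE unitfE det_Vandermonde.
  apply/prodf_neq0 => i _; apply/prodf_neq0 => j ij.
  rewrite !mxE subr_eq0 eqr_nat; apply/eqP => /val_inj/fI ji.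
  by rewrite ji ltnn in ij.
have xE i : `|x i 0| <= L * s.
  have -> : x i 0 = \sum_j invmx (V f) i j * dotcv (y (f j)) x.
    rewrite -[in LHS](mulKmx Vunit x) mxE; apply: eq_bigr => j _.
    rewrite dotcvE mxE; congr (_ * _); apply: eq_bigr => k _.
    by rewrite !mxE.
  apply: le_trans (ler_norm_sum _ _ _) _.
  apply: (@le_trans _ _ ((\sum_j l f i j) * s)).
    rewrite mulr_suml; apply: ler_sum => j _.
    by rewrite normrM -mulrA ler_wpM2l.
  apply: ler_wpM2r => //; apply: (@le_trans _ _ (\sum_i' \sum_j l f i' j)).
    rewrite [leRHS](bigD1 i)//= lerDl.
    by do 2 apply: sumr_ge0 => ? _.
  rewrite /L [leRHS](bigD1 f)//= lerDl.
  by do 3 apply: sumr_ge0 => ? _.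
rewrite dotcvE -mulrA mulr_natl -[X in _ *+ X](card_ord m) -sumr_const.
apply: ler_sum => i _; rewrite -expr2 -exprMn -real_normK ?num_real//.
by rewrite lerXn2r ?nnegrE ?mulr_ge0.
Qed.

(** The left side is the expected number of the [K] vectors, placed in the block, that are nearly
    orthogonal to the random point. [L] comes from general position in dimension [m] and is thus
    fixed before [d] and [h]. *)
Lemma small_ball_block (R : realType) (m K : nat) : (0 < m)%N ->
  exists L : R, 0 <= L /\
    forall (d : nat) (h : 'I_m -> 'I_d) (mu : probability (borel_cV R d) R)
      (v : 'cV[R]_d) (s : R),
    injective h -> uniform_on_sphere mu -> dotcv v v = 1 -> 0 <= s ->
    K%:R * fine (mu [set x | `|dotcv v x| <= s]) <= m%:R + K%:R *
      fine (mu [set x | \sum_i (x : 'cV[R]_d) (h i) 0 ^+ 2 <= L * s ^+ 2]).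
Proof.
move=> m0; have [u [L [u1 L0 uL]]] := general_position R K m0; exists L; split=> //.
move=> d h mu v s hI um v1 s0.
have mS : measurable (@sphere R d) by exact: measurable_sphere.
(* [w k] is [u k] spread over the coordinates selected by [h]; injectivity of [h] preserves its
   norm. *)
pose w k : 'cV[R]_d := \sum_i u k i 0 *: delta_mx (h i) 0.
have wE k (x : 'cV[R]_d) : dotcv (w k) x = dotcv (u k) (\col_i x (h i) 0).
  rewrite /w; rewrite dotcvE [RHS]dotcvE.
  under eq_bigr do rewrite summxE mulr_suml.
  rewrite exchange_big /=; apply: eq_bigr => i _.
  rewrite (bigD1 (h i))//= big1 => [|j ji]; last first.
    by rewrite !mxE (negbTE ji) mulr0 mul0r.
  by rewrite !mxE !eqxx mulr1 addr0.
have w1 k : dotcv (w k) (w k) = 1.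
  rewrite wE -[RHS](u1 k); congr dotcv; apply/colP => i; rewrite mxE summxE.
  rewrite (bigD1 i)//= big1 => [|j ji]; last first.
    by rewrite !mxE (inj_eq hI) eq_sym (negbTE ji) mulr0.
  by rewrite !mxE !eqxx mulr1 addr0.
pose A k : set (borel_cV R d) := [set x | `|dotcv (w k) x| <= s].
pose B : set (borel_cV R d) := [set x | \sum_i (x : 'cV[R]_d) (h i) 0 ^+ 2 <= L * s
  ^+ 2].
have mA k : measurable (A k).
  rewrite -[A k]setTI; apply: measurable_fun_le => //.
  apply: measurableT_comp => //; exact: measurable_dotcv.
have mB : measurable B.
  rewrite -[B]setTI; apply: measurable_fun_le => //.
  by apply: measurable_sum => i; apply: measurable_funX; exact: measurable_coord.
have AE k : mu (A k) = mu [set x | `|dotcv v x| <= s].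
  have mI : measurable [set y : R | `|y| <= s].
    rewrite -[X in measurable X]setTI; apply: measurable_fun_le => //.
  exact: (uniform_law um (w1 k) v1 mI).
have bI := bounded_measurable_indic R (@sphere R d).
have bc := bounded_measurable_cst (@sphere R d).
have PS := measure_sphere um.
have -> : K%:R * fine (mu [set x | `|dotcv v x| <= s]) =
    \int[mu]_(x in @sphere R d) (\sum_k 1 * \1_(A k) x).
  rewrite Rintegral_sum//; last by move=> k; exact: bI.
  under eq_bigr => k _ do rewrite mul1r Rintegral_indic// AE.
  by rewrite sumr_const card_ord mulr_natl.
have -> : m%:R + K%:R * fine (mu B) =
    \int[mu]_(x in @sphere R d) (m%:R + K%:R * \1_B x).
  rewrite RintegralD//; last 2 first.
  - by apply: bounded_measurable_integrable => //; exact: bc.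
  - apply: bounded_measurable_integrable => //.
    by apply: bounded_measurableM; [exact: bc|exact: bI].
  rewrite RintegralZl//; last by apply: bounded_measurable_integrable => //;
    exact: bI.
  rewrite Rintegral_indic// Rintegral_cst//; congr (_ + _).
  rewrite -[LHS]mulr1; congr (_ * _).
  exact: esym (congr1 fine PS).
apply: le_Rintegral => //.
- apply: bounded_measurable_integrable => //; apply: bounded_measurable_sum => k.
  by apply: bounded_measurableM; [exact: bc|exact: bI].
- apply: bounded_measurable_integrable => //; split.
    by apply: measurable_funD => //; apply: measurable_funM => //; exact: (bI _ mB).1.
  exists (m%:R + K%:R) => x _; rewrite ger0_norm ?addr_ge0 ?mulr_ge0// lerD2l.
  by rewrite -[leRHS]mulr1 ler_wpM2l// indicE lern1 leq_b1.
(* Pointwise comparison of counts: at most [K] when the block is small, and at most [m] otherwise by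
   general position. *)
move=> x _; under eq_bigr do rewrite mul1r indicE.
rewrite indicE -natr_sum -natrM -natrD ler_nat.
have -> : (\sum_(k < K) (x \in A k) = #|[pred k | (`|dotcv (w k) x| <= s)%R]|)%N.
  rewrite -sum1_card [RHS]big_mkcond; apply: eq_bigr => k _ /=.
  by rewrite inE; case: ifP => [kA|/negP kA]; [rewrite mem_set|rewrite memNset].
have [xB|/negP xB] := boolP (x \in B).
  by rewrite muln1 (leq_trans (max_card _))// card_ord leq_addl.
rewrite muln0 addn0 leqNgt; apply/negP => /ltnW mA'; apply: xB; rewrite inE.
have {mA'} : (m <= #|[pred k | (`|dotcv (u k) (\col_i (x : 'cV[R]_d) (h i) 0)| <=
  s)%R]|)%N.
  by apply: leq_trans mA' _; apply/subset_leq_card/fintype.subsetP => k;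
    rewrite !inE wE.
move=> /(uL _ _ s0); rewrite dotcvE /B /=; apply: le_trans.
by rewrite le_eqVlt; apply/orP; left; apply/eqP/eq_bigr => i _; rewrite mxE expr2.
Qed.

(** Half of [eps] pays for the ratio [m / K], the other half for the block being small. Dimensions
    below [m] use the whole vector as the block. *)
Lemma small_ball (R : realType) (eps : R) : 0 < eps ->
  exists2 delta : R, 0 < delta &
    forall (d : nat) (mu : probability (borel_cV R d) R) (v : 'cV[R]_d),
    (0 < d)%N -> uniform_on_sphere mu -> dotcv v v = 1 ->
    fine (mu [set x | d%:R * dotcv v x ^+ 2 <= delta]) <= eps.
Proof.
move=> e0; pose m := (Num.truncn (16 / eps)).+1.
have mP : 16 / eps < m%:R by exact: truncnS_gt.
have mR : 0 < m%:R :> R by rewrite ltr0n.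
have m8 : 8 / m%:R <= eps / 2.
  by rewrite ler_pdivrMr//; move: mP; rewrite ltr_pdivrMr// => mP; lra.
pose K := (Num.truncn (2 * m%:R / eps)).+1.
have KP : 2 * m%:R / eps < K%:R by exact: truncnS_gt.
have KR : 0 < K%:R :> R by rewrite ltr0n.
have mK : m%:R <= K%:R * (eps / 2).
  by move: KP; rewrite ltr_pdivrMr// => KP; lra.
(* Blocks must be nonempty, so [L n] is the constant for blocks of size [n.+1]. *)
have /choice[L LP] (n : nat) := small_ball_block R K (ltn0Sn n).
pose L' := 1 + \sum_(n < m) L n.
have L0 n : 0 <= L n by case: (LP n).
have L'0 : 0 < L' by rewrite ltr_pwDl// sumr_ge0.
have LL' n : (n < m)%N -> L n <= L'.
  move=> nm; rewrite /L' (bigD1 (Ordinal nm))//= addrCA lerDl addr_ge0//.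
  exact: sumr_ge0.
(* [L'] dominates the constants of all block sizes up to [m], so [L n * delta] is at most one half
   for each of them. *)
pose delta := (2 * L')^-1; have delta0 : 0 < delta by rewrite invr_gt0 mulr_gt0.
have Ldelta n : (n < m)%N -> L n * delta <= 2^-1.
  by move=> /LL' ?; rewrite /delta ler_pdivrMr ?mulr_gt0// mulrA mulVf// mul1r.
exists delta => // d mu v d0 um v1.
have dR : 0 < d%:R :> R by rewrite ltr0n.
pose s := Num.sqrt (delta / d%:R).
have s2 : s ^+ 2 = delta / d%:R by rewrite sqr_sqrtr// divr_ge0 ?ltW.
have -> : [set x | d%:R * dotcv v x ^+ 2 <= delta] = [set x | `|dotcv v x| <= s].
  apply/funext => x /=; congr is_true.
  by rewrite -sqrtr_sqr ler_sqrt ?divr_ge0 ?(ltW delta0)// ler_pdivlMr// mulrC.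
suff [n [h [nm hI q]]] : exists n : nat, exists h : 'I_n.+1 -> 'I_d, [/\ (n < m)%N,
    injective h & fine (mu [set x | \sum_i (x : 'cV[R]_d) (h i) 0 ^+ 2 <= L n * s
      ^+ 2]) <= eps / 2].
  have [_ /(_ d h mu v s hI um v1 (sqrtr_ge0 _))] := LP n.
  move=> h1; rewrite -(ler_pM2l KR); apply: le_trans h1 _.
  have -> : K%:R * eps = K%:R * (eps / 2) + K%:R * (eps / 2) by field.
  apply: lerD; last by rewrite ler_wpM2l.
  by apply: le_trans mK; rewrite ler_nat.
have mB n (h : 'I_n -> 'I_d) (c : R) :
    measurable ([set x | \sum_i (x : 'cV[R]_d) (h i) 0 ^+ 2 <= c] : set (borel_cV R
      d)).
  rewrite -[X in measurable X]setTI; apply: measurable_fun_le => //.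
  by apply: measurable_sum => i; apply: measurable_funX; exact: measurable_coord.
have mS : measurable (@sphere R d) by exact: measurable_sphere.
have PS := measure_sphere um.
have [md|dm] := leqP m d.
  exists m.-1, (widen_ord md); split=> //.
    by move=> i j /(congr1 val) /= /val_inj.
  apply: le_trans m8; apply: le_trans (uniform_block_le um (h := widen_ord md) _
    (ltn0Sn _)); last first.
    by move=> i j /(congr1 val) /= /val_inj.
  apply: (le_fine_probability mS PS) => // x _ /=.
  move=> /le_trans; apply; rewrite s2 mulrA invfM mulrA ler_pM2r ?invr_gt0//.
  by apply: le_trans (Ldelta _ (ltnSn _)) _; rewrite -[leLHS]mul1r ler_pM2r// ler1n.
case: d mu v d0 um v1 dR s s2 mB mS PS dm => // d mu v d0 um v1 dR s s2 mB mS PS dm.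
(* The block is the whole vector, of norm 1 on the sphere, while [L d * delta] is at most one half:
   the event is empty there. *)
exists d, id; split=> //; first exact: ltnW.
apply: (@le_trans _ _ (fine (mu set0))); last by rewrite measure0/= divr_ge0 ?ltW.
apply: (le_fine_probability mS PS) => // x /sphere_sum_sqr /= ->.
rewrite s2 mulrA ler_pdivlMr// mul1r => h.
have := Ldelta _ (ltnW dm); have : 1 <= d.+1%:R :> R by rewrite ler1n.
lra.
Qed.

(** Give index [k] the weight [q k]. On [D] the indices with a small projection carry at least half
    of the total weight [T], but their expected weight is at most [T * (eps / 2)]; Markov's
    inequality concludes. *)
Lemma small_ball_quadratic (R : realType) (eps : R) : 0 < eps ->
  exists2 delta : R, 0 < delta &
    forall (d n : nat) (mu : probability (borel_cV R d) R) (b : 'I_n -> 'cV[R]_d),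
    (0 < d)%N -> uniform_on_sphere mu -> 0 < \sum_k dotcv (b k) (b k) ->
    fine (mu [set x | d%:R * \sum_k dotcv (b k) x ^+ 2 <=
                      delta * \sum_k dotcv (b k) (b k)]) <= eps.
Proof.
move=> e0; have [delta delta0 sb] := @small_ball R (eps / 2) (divr_gt0 e0 (ltr0n _
  2)).
exists (delta / 2) => [|d n mu b d0 um]; first exact: divr_gt0.
pose q k := dotcv (b k) (b k); set T := (X in 0 < X) => T0.
pose D : set (borel_cV R d) := [set x | d%:R * \sum_k dotcv (b k) x ^+ 2 <= delta /
  2 * T].
pose A k : set (borel_cV R d) := [set x | d%:R * dotcv (b k) x ^+ 2 <= delta * q k].
rewrite -[X in mu X]/D.
have mS : measurable (@sphere R d) by exact: measurable_sphere.
have PS := measure_sphere um.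
have mA k : measurable (A k).
  rewrite -[A k]setTI; apply: measurable_fun_le => //.
  apply: measurable_funM => //; apply: measurable_funX; exact: measurable_dotcv.
have mD : measurable D.
  rewrite -[D]setTI; apply: measurable_fun_le => //; apply: measurable_funM => //.
  apply: measurable_sum => k; apply: measurable_funX; exact: measurable_dotcv.
have bI := bounded_measurable_indic R (@sphere R d).
have bc := bounded_measurable_cst (@sphere R d).
(* A zero vector has weight 0; any other [b k] is normalised before [small_ball] applies. *)
have AE k : q k * fine (mu (A k)) <= q k * (eps / 2).
  have [->|q0] := eqVneq (q k) 0; first by rewrite !mul0r.
  have qk : 0 < q k by rewrite lt_neqAle eq_sym q0 dotcv_ge0.
  rewrite ler_pM2l//; set v := (Num.sqrt (q k))^-1 *: b k.
  have v1 : dotcv v v = 1.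
    by rewrite dotcvZl dotcvZr mulrA -expr2 exprVn sqr_sqrtr ?ltW// mulVf.
  apply: le_trans (sb d mu v d0 um v1); rewrite le_eqVlt; apply/orP; left; apply/eqP.
  congr (fine (mu _)); apply/funext => x /=; congr is_true.
  rewrite dotcvZl exprMn exprVn sqr_sqrtr ?(ltW qk)// (mulrCA _ (q k)^-1)
    ler_pdivrMl//.
  by rewrite (mulrC (q k)).
have M : T / 2 * fine (mu D) <= \int[mu]_(x in @sphere R d) (\sum_k q k * \1_(A k) x).
  apply: markov_inequality => //.
  - by apply: bounded_measurable_sum => k; apply: bounded_measurableM;
      [exact: bc|exact: bI].
  - by move=> x _; apply: sumr_ge0 => k _; rewrite mulr_ge0 ?dotcv_ge0// indicE.
  move=> x _ Dx.
  (* Termwise, [q k] is covered by the indicator on [A k] and by the rescaled squared projection off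
     it. *)
  have H : T <= \sum_k (q k * \1_(A k) x + delta^-1 * (d%:R * dotcv (b k) x ^+ 2)).
    apply: ler_sum => k _; rewrite indicE -/(q k).
    have [xA|/negP xA] := boolP (x \in A k).
      by rewrite mulr1 lerDl mulr_ge0 ?invr_ge0 ?(ltW delta0)// mulr_ge0 ?sqr_ge0.
    rewrite mulr0 add0r -ler_pdivrMl ?invr_gt0// invrK leNgt; apply/negP => /ltW h.
    by apply: xA; rewrite inE.
  move: H; rewrite big_split /= -mulr_sumr -mulr_sumr => H.
  move: Dx; rewrite /D /= -(ler_pM2l (_ : 0 < delta^-1)) ?invr_gt0// => Dx.
  have E : delta^-1 * (delta / 2 * T) = T / 2 by field; rewrite gt_eqF.
  rewrite E in Dx; lra.
rewrite Rintegral_sum// in M; last by move=> k; exact: bI.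
have T2 : 0 < T / 2 by rewrite divr_gt0.
rewrite -(ler_pM2l T2) (le_trans M)//.
rewrite (_ : T / 2 * eps = \sum_k q k * (eps / 2));
  last by rewrite -mulr_suml -/T; field.
by apply: ler_sum => k _; rewrite Rintegral_indic.
Qed.

(** * Two-sided tightness of the ratio *)

Lemma fine_probabilityU (disp : measure_display) (T : measurableType disp)
    (R : realType) (P : probability T R) (A B : set T) :
  measurable A -> measurable B -> fine (P (A `|` B)) <= fine (P A) + fine (P B).
Proof.
move=> mA mB; rewrite -fineD ?fin_num_measure//.
apply: fine_le; rewrite ?fin_numD ?fin_num_measure//; first exact: measurableU.
exact: measureU2.
Qed.

(** Numerator and denominator, each scaled to mean 1, can be too large or too small: four bad events
    [B1] to [B4] of probability at most [eps / 4]. Off them the ratio lies between [d1 / A] and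
    [A / d2]. *)
Lemma uniform_ratio_tight (R : realType) (eps : R) : 0 < eps ->
  exists c C : R, [/\ 0 < c, 0 < C &
    forall (d n : nat) (mu : probability (borel_cV R d) R) (v : 'cV[R]_d)
      (b : 'I_n -> 'cV[R]_d) (q : 'cV[R]_d -> R) (T : R),
    (0 < d)%N -> uniform_on_sphere mu -> v != 0 ->
    (forall x, q x = \sum_k dotcv (b k) x ^+ 2) ->
    T = \sum_k dotcv (b k) (b k) -> 0 < T ->
    ((1 - eps)%:E <= mu [set x | 
       (c <= dotcv v x ^+ 2 / q x * (T / dotcv v v) <= C)%R])%E].
Proof.
move=> e0; have e4 : 0 < eps / 4 by rewrite divr_gt0.
have [d1 d10 sb1] := small_ball e4.
have [d2 d20 sb2] := small_ball_quadratic e4.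
(* Markov's inequality for a variable of mean 1 exceeds this level with probability at most
   [eps / 4]. *)
pose A := 4 / eps; have A0 : 0 < A by rewrite divr_gt0.
have cP : 0 < d1 / A by rewrite divr_gt0.
exists (d1 / A), (A / d2); split; [exact: cP|by rewrite divr_gt0|].
move=> d n mu v b q T dpos um v0 qE TE T0.
have mS : measurable (@sphere R d) by exact: measurable_sphere.
have PS := measure_sphere um.
have dR : 0 < d%:R :> R by rewrite ltr0n.
have vv : 0 < dotcv v v by rewrite lt_neqAle dotcv_ge0 eq_sym dotcv_eq0 v0.
pose w := (Num.sqrt (dotcv v v))^-1 *: v.
have w2 x : dotcv w x ^+ 2 = dotcv v x ^+ 2 / dotcv v v.
  by rewrite dotcvZl exprMn exprVn sqr_sqrtr ?dotcv_ge0// mulrC.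
have w1 : dotcv w w = 1.
  by rewrite dotcvZl dotcvZr mulrA -expr2 exprVn sqr_sqrtr ?dotcv_ge0// mulVf//
    gt_eqF.
have bq u : bounded_measurable (@sphere R d) (fun x => dotcv u x ^+ 2).
  by apply: bounded_measurableX; exact: bounded_measurable_dotcv.
have bc := bounded_measurable_cst (@sphere R d).
have qf : q = fun x => \sum_k dotcv (b k) x ^+ 2 by apply/funext.
have bqq : bounded_measurable (@sphere R d) q by rewrite qf;
  exact: bounded_measurable_sum.
have q0 x : 0 <= q x by rewrite qE sumr_ge0// => k _; exact: sqr_ge0.
pose B1 : set (borel_cV R d) := [set x | A <= d%:R * dotcv w x ^+ 2].
pose B2 : set (borel_cV R d) := [set x | d%:R * dotcv w x ^+ 2 <= d1].
pose B3 : set (borel_cV R d) := [set x | A * T <= d%:R * q x].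
pose B4 : set (borel_cV R d) := [set x | d%:R * q x <= d2 * T].
have mle (f g : borel_cV R d -> R) : measurable_fun setT f -> measurable_fun setT g ->
    measurable [set x | f x <= g x].
  move=> mf mg; rewrite -[X in measurable X]setTI; exact: measurable_fun_le.
have mdw : measurable_fun [set: borel_cV R d] (fun x => d%:R * dotcv w x ^+ 2).
  by apply: measurable_funM => //; exact: (bq w).1.
have mdq : measurable_fun [set: borel_cV R d] (fun x => d%:R * q x).
  by apply: measurable_funM => //; exact: bqq.1.
have mB1 : measurable B1 by exact: mle.
have mB2 : measurable B2 by exact: mle.
have mB3 : measurable B3 by exact: mle.
have mB4 : measurable B4 by exact: mle.
have P1 : fine (mu B1) <= eps / 4.
  rewrite -(ler_pM2l A0) (_ : A * (eps / 4) = 1); last by rewrite /A; field;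
    rewrite gt_eqF.
  have <- : \int[mu]_(x in @sphere R d) (d%:R * dotcv w x ^+ 2) = 1.
    rewrite RintegralZl//; last exact: bounded_measurable_integrable.
    by rewrite uniform_second_moment// mulfV// gt_eqF.
  apply: markov_inequality => //; first by apply: bounded_measurableM => //.
  by move=> x _; rewrite mulr_ge0// sqr_ge0.
have P2 : fine (mu B2) <= eps / 4 by exact: sb1.
have P4 : fine (mu B4) <= eps / 4.
  rewrite (_ : B4 = [set x | d%:R * \sum_k dotcv (b k) x ^+ 2 <= d2 * \sum_k dotcv
    (b k) (b k)]).
    by apply: sb2 => //; rewrite -TE.
  by rewrite /B4 TE qf.
have Eb k : \int[mu]_(x in @sphere R d) dotcv (b k) x ^+ 2 = dotcv (b k) (b k) / d%:R.
  have [bk0|bk0] := eqVneq (b k) 0.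
    rewrite bk0 (_ : dotcv 0 0 = 0); last by apply/eqP; rewrite dotcv_eq0.
    rewrite mul0r (@eq_Rintegral _ _ _ _ _ (fun=> 0)) ?Rintegral_cst ?mul0r//.
    by move=> x _; rewrite -(scale0r 0) dotcvZl mul0r expr0n.
  have bb : 0 < dotcv (b k) (b k) by rewrite lt_neqAle dotcv_ge0 eq_sym dotcv_eq0 bk0.
  pose u := (Num.sqrt (dotcv (b k) (b k)))^-1 *: b k.
  have u1 : dotcv u u = 1.
    by rewrite dotcvZl dotcvZr mulrA -expr2 exprVn sqr_sqrtr ?dotcv_ge0// mulVf//
      gt_eqF.
  rewrite -(uniform_second_moment um u1) -RintegralZl//;
    last exact: bounded_measurable_integrable.
  apply: eq_Rintegral => x _.
  by rewrite dotcvZl exprMn exprVn sqr_sqrtr ?dotcv_ge0// mulVKf// gt_eqF.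
have P3 : fine (mu B3) <= eps / 4.
  have AT : 0 < A * T by rewrite mulr_gt0.
  rewrite -(ler_pM2l AT) (_ : A * T * (eps / 4) = T); last by rewrite /A; field;
    rewrite gt_eqF.
  have TI : \int[mu]_(x in @sphere R d) (d%:R * q x) = T.
    rewrite qf; under eq_Rintegral do rewrite mulr_sumr.
    rewrite Rintegral_sum// TE; apply: eq_bigr => k _.
    by rewrite Eb mulrCA mulfV ?mulr1// gt_eqF.
  rewrite -[leRHS]TI; apply: markov_inequality => //.
    by apply: bounded_measurableM => //.
  by move=> x _; rewrite mulr_ge0.
pose E : set (borel_cV R d) := [set x | (d1 / A <= dotcv v x ^+ 2 / q x * (T /
  dotcv v v) <= A / d2)%R].
change ((1 - eps)%:E <= mu E)%E.
(* Where [q x] is 0 the quotient is 0 by convention, hence below the positive lower bound. So [E]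
   forces [0 < q x], and clearing denominators makes it visibly measurable. *)
have EE : E = [set x | 0 < q x] `&` [set x | d1 / A * q x <= dotcv w x ^+ 2 * T]
    `&` [set x | dotcv w x ^+ 2 * T <= A / d2 * q x].
  apply/seteqP; split=> x.
    rewrite /E /= => /andP[].
    have [q_0|qn0] := eqVneq (q x) 0.
      by rewrite q_0 invr0 mulr0 mul0r leNgt cP.
    have qp : 0 < q x by rewrite lt_neqAle eq_sym qn0 q0.
    have -> : dotcv v x ^+ 2 / q x * (T / dotcv v v) = dotcv w x ^+ 2 * T / q x.
      by rewrite w2; field; rewrite !gt_eqF.
    by rewrite ler_pdivlMr// ler_pdivrMr.
  move=> [[qp h1] h2]; rewrite /E /=.
  have -> : dotcv v x ^+ 2 / q x * (T / dotcv v v) = dotcv w x ^+ 2 * T / q x.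
    by rewrite w2; field; rewrite !gt_eqF.
  by rewrite ler_pdivlMr// ler_pdivrMr//; apply/andP.
have mE : measurable E.
  rewrite EE; apply: measurableI; first apply: measurableI.
  - rewrite (_ : mkset _ = ~` [set x | q x <= 0]).
      by apply: measurableC; apply: mle => //; exact: bqq.1.
    by apply/seteqP; split=> x /=; rewrite ltNge => /negP.
  - apply: mle; first by apply: measurable_funM => //; exact: bqq.1.
    by apply: measurable_funM => //; exact: (bq w).1.
  - apply: mle; last by apply: measurable_funM => //; exact: bqq.1.
    by apply: measurable_funM => //; exact: (bq w).1.
have mEC : measurable (~` E) by exact: measurableC.
have PEC : fine (mu (~` E)) <= eps.
  apply: (@le_trans _ _ (fine (mu (B1 `|` B2 `|` (B3 `|` B4))))).
    apply: (le_fine_probability mS PS) => //; first by do ?[apply: measurableU].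
    move=> x _; rewrite EE => nE; apply: contrapT => nB; apply: nE.
    have [[n1 n2] [n3 n4]] : (~ B1 x /\ ~ B2 x) /\ (~ B3 x /\ ~ B4 x).
      split; split=> h; apply: nB; [left; left|left; right|right; left|right;
        right]; exact: h.
    move/negP: n1; move/negP: n2; move/negP: n3; move/negP: n4.
    rewrite -!ltNge => n4 n3 n2 n1.
    have qp : 0 < q x by rewrite -(pmulr_rgt0 _ dR) (lt_trans _ n4)// mulr_gt0.
    split; [split=> //=|] => /=.
      rewrite [leLHS]mulrAC ler_pdivrMr// -(ler_pM2l dR).
      apply: (@le_trans _ _ (d1 * (A * T))).
        by rewrite mulrCA ler_wpM2l ?ltW.
      rewrite (_ : _ * (_ * A) = (d%:R * dotcv w x ^+ 2) * (A * T)); last by ring.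
      by rewrite ler_wpM2r ?ltW// mulr_gt0.
    rewrite [leRHS]mulrAC ler_pdivlMr// -(ler_pM2l dR).
    apply: (@le_trans _ _ (A * (T * d2))).
      rewrite (_ : d%:R * _ = d%:R * dotcv w x ^+ 2 * (T * d2)); last by ring.
      by rewrite ler_wpM2r ?(ltW n1)// mulr_ge0 ?ltW.
    by rewrite [leRHS]mulrCA (ler_pM2l A0) mulrC ltW.
  apply: le_trans (fine_probabilityU _ _ _) _; try exact: measurableU.
  have -> : eps = eps / 4 + eps / 4 + (eps / 4 + eps / 4) by field.
  by apply: lerD; (apply: le_trans (fine_probabilityU _ _ _) _ => //; exact: lerD).
have : mu (~` E) = (1 - mu E)%E by rewrite probability_setC.
move: PEC => /[swap] ->.
have fE : mu E \is a fin_num by rewrite fin_num_measure.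
by rewrite -[mu E]fineK// -EFinB /= lee_fin => ?; lra.
Qed.

(** * Covariance matrices and the theorem *)

Lemma covmxE (disp : measure_display) (Om : measurableType disp) (R : realType)
    (P : probability Om R) (d : nat) (X : Om -> 'cV[R]_d) (l m : 'I_d) :
  covmx P X l m = \int[P]_(w in setT)
    ((X w l 0 - fine ('E_P[fun w => X w l 0])) *
     (X w m 0 - fine ('E_P[fun w => X w m 0]))).
Proof. by rewrite mxE covariance.unlock unlock. Qed.

(* Junk value: the real part of an infinite variance is 0, so that positive
   diagonal entries force finite variances. *)
Lemma covmx_psd (disp : measure_display) (Om : measurableType disp)
    (R : realType) (P : probability Om R) (d : nat) (X : Om -> 'cV[R]_d) :
  (forall l, measurable_fun setT (fun w => X w l 0)) ->
  (forall l, 0 < covmx P X l l) ->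
  (covmx P X)^T = covmx P X /\
  forall x : 'cV[R]_d, 0 <= (x^T *m covmx P X *m x) 0 0.
Proof.
move=> mX v0; pose Z l w := X w l 0 - fine ('E_P[fun w => X w l 0]).
have cE l m : covmx P X l m = \int[P]_(w in setT) (Z l w * Z m w).
  exact: covmxE.
have mZ l : measurable_fun setT (Z l) by apply: measurable_funB.
have iZZ l : P.-integrable setT (EFin \o (fun w => Z l w * Z l w)).
  apply/integrableP; split.
    by apply/measurable_EFinP; exact: measurable_funM.
  rewrite (eq_integral (fun w => (Z l w * Z l w)%:E)) => [|w _ /=]; last first.
    by rewrite ger0_norm// -expr2 sqr_ge0.
  rewrite ltey; apply/eqP => I; have := v0 l.
  by rewrite cE /Rintegral I ltxx.
have iZ l m : P.-integrable setT (EFin \o (fun w => Z l w * Z m w)).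
  (* A product is dominated in absolute value by the sum of the two squares. *)
  apply: (le_integrable _ _ _ (integrableD _ (iZZ l) (iZZ m))) => //.
    by apply/measurable_EFinP; exact: measurable_funM.
  move=> w _ /=; rewrite lee_fin normrM.
  rewrite [leRHS]ger0_norm; last by rewrite addr_ge0// -expr2 sqr_ge0.
  rewrite -(normrM (Z l w)) ler_norml; apply/andP; split; nra.
split=> [|x].
  by apply/matrixP => l m; rewrite mxE !cE; apply: eq_Rintegral => w _; rewrite mulrC.
have -> : (x^T *m covmx P X *m x) 0 0 =
    \int[P]_(w in setT) (\sum_l x l 0 * \sum_m x m 0 * (Z l w * Z m w)).
  have S l := integrable_Rintegral_sum (index_enum 'I_d) (fun m => x m 0)
    measurableT (iZ l).
  rewrite (integrable_Rintegral_sum _ _ measurableT (fun l => (S l).1)).2.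
  rewrite -mulmxA mxE; apply: eq_bigr => l _; rewrite !mxE (S l).2.
  by congr (_ * _); apply: eq_bigr => m _; rewrite cE mulrC.
apply: Rintegral_ge0 => w _.
(* The form at [x] is the mean of the square of the centred combination with coefficients [x]. *)
rewrite (_ : \sum_l _ = (\sum_l x l 0 * Z l w) ^+ 2) ?sqr_ge0//.
rewrite expr2 mulr_suml; apply: eq_bigr => l _; rewrite !mulr_sumr.
by apply: eq_bigr => m _; ring.
Qed.

Lemma dotcv_mulmx (R : realType) (m n : nat) (A : 'M[R]_(m, n)) (x : 'cV[R]_m)
    (y : 'cV[R]_n) : dotcv x (A *m y) = dotcv (A^T *m x) y.
Proof. by rewrite /dotcv trmx_mul trmxK mulmxA. Qed.

(** Together with [mxtrace_gram], this lets the rows of a factor [B] serve as the vectors [b k] of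
    [uniform_ratio_tight], with the trace as total weight. *)
Lemma sum_dotcv_row (R : realType) (n m : nat) (B : 'M[R]_(m, n)) (x : 'cV[R]_n) :
  \sum_k dotcv (row k B)^T x ^+ 2 = (x^T *m (B^T *m B) *m x) 0 0.
Proof.
rewrite mulmxA -mulmxA -trmx_mul -/(dotcv (B *m x) (B *m x)) dotcvE.
by apply: eq_bigr => k _; rewrite /dotcv trmxK -row_mul mxE expr2.
Qed.

Lemma mxtrace_gram (R : realType) (n m : nat) (B : 'M[R]_(m, n)) :
  \tr (B^T *m B) = \sum_k dotcv (row k B)^T (row k B)^T.
Proof.
rewrite mxtrace_mulC; apply: eq_bigr => k _; rewrite mxE dotcvE.
by apply: eq_bigr => j _; rewrite !mxE.
Qed.

Theorem theorem2p8 (R : realType)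
    (T : nat) (hT : (0 < T)%N)
    (disp : nat -> measure_display) (Om : forall d, measurableType (disp d))
    (P : forall d, probability (Om d) R)
    (nu C' : R) (hnu : 2 < nu)
    (eta : forall d, nat -> 'I_T -> {RV (P d) >-> R})
    (a : forall d, nat -> 'cV[R]_d)
    (e : forall d, 'I_T -> {RV (P d) >-> borel_cV R d})
    (herr : forall d, (0 < d)%N -> linear_errors nu C' (eta d) (a d) (e d))
    (Sigma : forall d, 'M[R]_d)
    (hSigma : forall d, (0 < d)%N ->
       Sigma d = covmx (P d) (e d (Ordinal hT)))
    (hvar : forall d (l : 'I_d), 0 < Sigma d l l)
    (M : forall d, 'M[R]_d) (hM : forall d, (0 < d)%N -> posdefmx (M d))
    (Delta : forall d, 'cV[R]_d)
    (hDelta : forall d, (0 < d)%N -> euclid_norm (Delta d) != 0)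
    (dispr : nat -> measure_display)
    (Omr : forall d, measurableType (dispr d))
    (Pr : forall d, probability (Omr d) R)
    (r : forall d, {RV (Pr d) >-> borel_cV R d})
    (hr : forall d, (0 < d)%N -> uniform_on_sphere (distribution (Pr d) (r d)))
    (eps : R) (heps : 0 < eps) :
  exists c C : R, [/\ 0 < c, 0 < C &
    forall d, (0 < d)%N ->
      ((1 - eps)%:E <=
       Pr d [set w |
         let S := invsqrtmx (M d) in
         (c <= efficiency1 (Sigma d) (Delta d) (S *m r d w) ^+ 2
               * (\tr (S *m Sigma d *m S) / euclid_norm (S *m Delta d) ^+ 2)
            <= C)%R])%E].
Proof.
have [c [C [c0 C0 cC]]] := uniform_ratio_tight heps.
exists c, C; split=> // -[//|d] dpos.
set S := invsqrtmx (M d.+1); set v := S *m Delta d.+1.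
have [ST Sunit] := invsqrtmxP (hM d.+1 isT).
have [SgT Sg0] : (Sigma d.+1)^T = Sigma d.+1 /\
    forall x : 'cV[R]_d.+1, 0 <= (x^T *m Sigma d.+1 *m x) 0 0.
  have := hvar d.+1; rewrite hSigma//; apply: covmx_psd => l.
  by apply: (measurableT_comp (measurable_coord l)); exact: measurable_funP.
pose N := S *m Sigma d.+1 *m S.
have NT : N^T = N by rewrite /N !trmx_mul ST SgT mulmxA.
have NE (x : 'cV[R]_d.+1) : x^T *m N *m x = (S *m x)^T *m Sigma d.+1 *m (S *m x).
  by rewrite trmx_mul ST /N !mulmxA.
have [x|B BT BN] := @psd_root R d 2 N isT NT; first by rewrite NE.
have {}BN : B^T *m B = N by rewrite BT -BN expr2.
(* A vanishing trace would make every row of [B] zero, hence [N] and, [S] being invertible, [Sigma]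
   zero, against its positive diagonal. *)
have trN0 : 0 < \tr N.
  rewrite -BN mxtrace_gram lt_neqAle eq_sym sumr_ge0 ?andbT; last first.
    by move=> k _; exact: dotcv_ge0.
  rewrite psumr_eq0; last by move=> k _; exact: dotcv_ge0.
  apply/negP => /allP B0; have {}B0 : B = 0.
    apply/row_matrixP => k; rewrite row0; apply: trmx_inj; rewrite trmx0.
    by apply/eqP; rewrite -dotcv_eq0; apply: (B0 k); rewrite mem_index_enum.
  have Sg : Sigma d.+1 = 0.
    rewrite -(mulKmx Sunit (Sigma d.+1)) -(mulmxK Sunit (S *m Sigma d.+1)).
    by rewrite -/N -BN B0 !(mulmx0, mul0mx).
  by have := hvar d.+1 ord0; rewrite Sg mxE ltxx.
have v0 : v != 0.
  apply: contra (hDelta d.+1 isT) => /eqP Sv.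
  rewrite -(mulKmx Sunit (Delta d.+1)) -/v Sv mulmx0 /euclid_norm big1 ?sqrtr0// =>
    i _.
  by rewrite mxE expr0n.
have := cC d.+1 d.+1 _ v (fun k => (row k B)^T) (fun x => (x^T *m N *m x) 0 0)
  (\tr N) isT (hr d.+1 isT) v0.
rewrite -BN => /(_ (fun x => esym (sum_dotcv_row B x)) (mxtrace_gram B)).
rewrite BN => /(_ trN0); congr (_ <= _)%E.
rewrite /distribution /pushforward; congr (Pr _ _); apply/seteqP.
(* Symmetry of [S] moves it from the random direction onto [Delta], and [tau] squares to the form of
   [N] because [Sigma] is positive semidefinite. *)
have E (x : 'cV[R]_d.+1) :
    efficiency1 (Sigma d.+1) (Delta d.+1) (S *m x) ^+ 2
      * (\tr N / euclid_norm v ^+ 2) =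
    dotcv v x ^+ 2 / (x^T *m N *m x) 0 0 * (\tr N / dotcv v v).
  rewrite sqr_euclid_norm /efficiency1 expr_div_n real_normK ?num_real//.
  by rewrite dotcv_mulmx ST -/v /tau sqr_sqrtr ?Sg0// NE.
by split=> w /=; rewrite -E.
Qed.
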